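(* There exists a skew brace $A=(A,\oplus,\odot)$ whose additive group $A_{\oplus}$ is solvable and whose multiplicative group $A_{\odot}$ is not solvable.
   Context: A skew brace $A=(A,\oplus,\odot)$ is a set with two binary operations $\oplus,\odot$ such that $A_{\oplus}=(A,\oplus)$ (the additive group, not necessarily abelian) and $A_{\odot}=(A,\odot)$ (the multiplicative group) are groups and $a\odot(b\oplus c)=(a\odot b)\ominus a\oplus(a\odot c)$ for all $a,b,c\in A$. Here $\ominus a$ denotes the inverse of $a$ in $A_{\oplus}$, and $x\ominus y$ means $x\oplus(\ominus y)$. Skew braces are not assumed to be finite. *)

(* Defs.v *)
From HB Require Import structures.
From mathcomp Require Import all_boot.

Set Implicit Arguments.
Unset Strict Implicit.
Unset Printing Implicit Defensive.

Local Open Scope group_scope.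

(* The inherited group structure on A is the multiplicative one, written     *)
(* x * y, 1, x^-1 in group_scope; the mixin adds the additive group and the  *)
(* compatibility law  a * (b + c) = (a * b) - a + (a * c).                   *)
HB.mixin Record Group_isSkewBrace A of Group A := {
  sbadd : A -> A -> A;
  sbzero : A;
  sbopp : A -> A;
  sbaddA : associative sbadd;
  sbadd0r : left_id sbzero sbadd;
  sbaddr0 : right_id sbzero sbadd;
  sbaddNr : left_inverse sbzero sbopp sbadd;
  sbaddrN : right_inverse sbzero sbopp sbadd;
  sbmulDr : forall a b c : A,
    a * sbadd b c = sbadd (sbadd (a * b) (sbopp a)) (a * c)
}.

#[short(type="skewBraceType")]
HB.structure Definition SkewBrace := {A of Group_isSkewBrace A & Group A}.

Definition multiplicative_group (A : skewBraceType) : groupType := A.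

(* A copy of the carrier whose canonical group structure is the additive one. *)
Definition additive_group (A : skewBraceType) : Type := A.

HB.instance Definition _ (A : skewBraceType) := Choice.on (additive_group A).
HB.instance Definition _ (A : skewBraceType) :=
  isGroup.Build (additive_group A) (@sbaddA A) (@sbadd0r A) (@sbaddr0 A)
    (@sbaddNr A) (@sbaddrN A).

(* Solvability is defined here for arbitrary groups because the predicate    *)
(* [solvable] of the library only concerns finite groups.                    *)
Section Solvability.
Variable G : groupType.
Implicit Type H S : G -> Prop.

Inductive generated_subgroup S : G -> Prop :=
  | gen_incl x : S x -> generated_subgroup S x
  | gen_one : generated_subgroup S 1
  | gen_mul x y : generated_subgroup S x -> generated_subgroup S y ->
      generated_subgroup S (x * y)
  | gen_inv x : generated_subgroup S x -> generated_subgroup S x^-1.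

Definition derived_subgroup H : G -> Prop :=
  generated_subgroup (fun z => exists x y, [/\ H x, H y & z = [~ x, y]]).

Definition derived_series (n : nat) : G -> Prop :=
  iter n derived_subgroup (fun=> True).

Definition solvable_group : Prop :=
  exists n, forall x : G, derived_series n x -> x = 1.

End Solvability.

(* Main.v *)
Require Import Defs.
From HB Require Import structures.
From mathcomp Require Import all_boot.
From mathcomp Require Import all_algebra.
From mathcomp Require Import boolp.

(** The adjoint group of a Jacobson radical ring [J], that is [1 + J] under
    multiplication, carries a skew brace structure whose additive group is
    [J], transported by [x |-> x - 1]; so it is abelian.  It suffices to find
    [J] such that [1 + J] is not solvable.

    Take for [J] the 3 x 3 matrices over the maximal ideal [2 Z_(2)] of the
    rationals with odd denominator.  Then [1 + J] is the principal congruence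
    subgroup of level 2 in [GL_3(Z_(2))].  It contains the transvections
    [1 + 2 a E_ij], and for distinct [i, j, l] the relation
      [[~ 1 + x E_ij, 1 + y E_jl] = 1 + x y E_il]
    shows that every term of the derived series contains nontrivial
    off-diagonal transvections ([derived_series_transvection]): the middle
    index [j] that the relation requires is always available in dimension 3. *)

Set Implicit Arguments.
Unset Strict Implicit.
Unset Printing Implicit Defensive.

Import GRing.Theory Num.Theory.
Local Open Scope ring_scope.

(** * The congruence subgroup of level 2 over the integers localised at 2 *)

(** Congruence to the identity modulo 2 over [Z_(2)], expressed with a common
    odd denominator [b] and an integral numerator [Y], so that the reduction
    modulo 2 is only ever applied to integers. *)
Definition congruent1 (X : 'M[rat]_3) : Prop :=
  exists b : int, exists Y : 'M[int]_3,
    [/\ b%:~R = 1 :> 'F_2, map_mx intr Y = 1 :> 'M['F_2]_3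
      & b%:~R *: X = map_mx intr Y].

Lemma odd_neq0 (b : int) : b%:~R = 1 :> 'F_2 -> b%:~R != 0 :> rat.
Proof.
move=> b1; rewrite intr_eq0; apply/eqP => b0.
by move: b1; rewrite b0 => /eqP; rewrite eq_sym oner_eq0.
Qed.

Lemma congruent1_1 : congruent1 1.
Proof. by exists 1, 1; rewrite !map_mx1 scale1r. Qed.

Lemma congruent1M X X' : congruent1 X -> congruent1 X' -> congruent1 (X * X').
Proof.
move=> [b [Y [b1 Y1 bX]]] [b' [Y' [b1' Y1' bX']]].
exists (b * b'), (Y * Y'); rewrite !rmorphM /= b1 b1' Y1 Y1' !mul1r -bX -bX'.
by rewrite -scalerAl -scalerAr scalerA.
Qed.

Lemma congruent1_shift X X' X'' : congruent1 X -> congruent1 X' ->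
  congruent1 X'' -> congruent1 (X - X' + X'').
Proof.
move=> [b [Y [b1 Y1 bX]]] [c [Z [c1 Z1 cX]]] [d [T [d1 T1 dX]]].
exists (b * c * d), ((c * d) *: Y - (b * d) *: Z + (b * c) *: T).
rewrite !rmorphM /= b1 c1 d1 !(map_mxD, map_mxN, map_mxZ) /= !rmorphM /=.
rewrite b1 c1 d1 Y1 Z1 T1 -bX -cX -dX !mulr1 !scale1r subrr add0r.
split=> //; rewrite scalerDr scalerBr !scalerA.
congr (_ *: _ - _ *: _ + _); last by rewrite mulrAC.
by rewrite -mulrA mulrC.
Qed.

(** The determinant of the numerator is odd, because reduction modulo 2 commutes
    with determinants; it serves as the denominator of the inverse, whose
    numerator is a multiple of the adjugate. *)
Lemma congruent1V X : congruent1 X -> X \is a GRing.unit /\ congruent1 X^-1.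
Proof.
move=> [b [Y [b1 Y1 bX]]].
have d1 : (\det Y)%:~R = 1 :> 'F_2 by rewrite -det_map_mx Y1 det1.
have adj1 : map_mx intr (\adj Y) = 1 :> 'M['F_2]_3.
  by rewrite map_mx_adj Y1 -[LHS]mul1mx mul_mx_adj det1.
have bN0 := odd_neq0 b1; have dN0 := odd_neq0 d1.
have XV : X * (((\det Y)%:~R^-1 * b%:~R) *: map_mx intr (\adj Y)) = 1.
  rewrite -mulmxE -scalemxAr -scalerA scalemxAl bX -map_mxM mul_mx_adj.
  by rewrite map_scalar_mx scale_scalar_mx mulVf.
have [Xu _] := mulmx1_unit XV.
split=> //; exists (\det Y), (b *: \adj Y).
rewrite !map_mxZ /= adj1 b1 scale1r; split=> //.
have := canRL (mulKr Xu) XV; rewrite mulr1 => <-.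
by rewrite scalerA mulrA mulfV // mul1r.
Qed.

Definition congruence_group : Type := {X : 'M[rat]_3 | `[< congruent1 X >]}.

HB.instance Definition _ := Choice.on congruence_group.

Implicit Types x y z : congruence_group.

Lemma congP x : congruent1 (val x). Proof. exact/asboolP/(valP x). Qed.

Definition cong X (cX : congruent1 X) : congruence_group :=
  exist _ X (asboolT cX).

Definition cong_one := cong congruent1_1.
Definition cong_mul x y := cong (congruent1M (congP x) (congP y)).
Definition cong_inv x := cong (congruent1V (congP x)).2.

Lemma cong_mulA : associative cong_mul.
Proof. by move=> x y z; apply: val_inj; apply: mulrA. Qed.
Lemma cong_mul1g : left_id cong_one cong_mul.
Proof. by move=> x; apply: val_inj; apply: mul1r. Qed.
Lemma cong_mulg1 : right_id cong_one cong_mul.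
Proof. by move=> x; apply: val_inj; apply: mulr1. Qed.
Lemma cong_mulVg : left_inverse cong_one cong_inv cong_mul.
Proof. by move=> x; apply/val_inj/mulVr/(congruent1V (congP x)).1. Qed.
Lemma cong_mulgV : right_inverse cong_one cong_inv cong_mul.
Proof. by move=> x; apply/val_inj/mulrV/(congruent1V (congP x)).1. Qed.

HB.instance Definition _ := isGroup.Build congruence_group
  cong_mulA cong_mul1g cong_mulg1 cong_mulVg cong_mulgV.

(** * The skew brace structure *)

(** Addition of the radical ring, transported along [x |-> x - 1]: the matrix
    [1] becomes the neutral element, and the opposite of [x] is [2 - x]. *)
Definition cong_add x y :=
  cong (congruent1_shift (congP x) congruent1_1 (congP y)).
Definition cong_opp x :=
  cong (congruent1_shift congruent1_1 (congP x) congruent1_1).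

Lemma cong_addC : commutative cong_add.
Proof. by move=> x y; apply: val_inj; rewrite /= addrC addrA addrAC. Qed.

Lemma cong_addA : associative cong_add.
Proof. by move=> x y z; apply: val_inj; rewrite /= !addrA. Qed.

Lemma cong_add0r : left_id cong_one cong_add.
Proof. by move=> x; apply: val_inj; rewrite /= subrr add0r. Qed.

Lemma cong_addr0 : right_id cong_one cong_add.
Proof. by move=> x; rewrite cong_addC cong_add0r. Qed.

Lemma cong_addNr : left_inverse cong_one cong_opp cong_add.
Proof. by move=> x; apply: val_inj; rewrite /= addrK subrK. Qed.

Lemma cong_addrN : right_inverse cong_one cong_opp cong_add.
Proof. by move=> x; rewrite cong_addC cong_addNr. Qed.

Lemma cong_mulDr x y z :
  (x * cong_add y z =
    cong_add (cong_add (x * y) (cong_opp x)) (x * z))%g.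
Proof.
apply: val_inj; rewrite /= !mulrDr mulrN mulr1 !addrA; congr (_ + _).
by rewrite subrK addrK.
Qed.

HB.instance Definition _ := Group_isSkewBrace.Build congruence_group
  cong_addA cong_add0r cong_addr0 cong_addNr cong_addrN cong_mulDr.

(** * Solvability of the two groups *)

Lemma commutative_solvable (G : groupType) :
  (forall x y : G, x * y = y * x)%g -> solvable_group G.
Proof.
move=> mulC; exists 1%N => x /=.
elim=> {x} [x [y [z [_ _ ->]]]||x y _ -> _ ->|x _ ->].
- exact/eqP/commgP/mulC.
- by [].
- exact: mulg1.
- exact: invg1.
Qed.

Lemma congruent1_transvection (i j : 'I_3) (a : int) :
  congruent1 (1 + (2 * a)%:~R *: delta_mx i j).
Proof.
exists 1, (1 + (2 * a) *: delta_mx i j).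
rewrite scale1r !map_mxD !map_mx1 !map_mxZ !map_delta_mx rmorphM /=.
have -> : 2%:~R = 0 :> 'F_2 by apply/val_inj.
by rewrite mul0r scale0r addr0.
Qed.

Definition transvection (i j : 'I_3) (a : int) : congruence_group :=
  cong (congruent1_transvection i j a).

Lemma transvection_neq1 i j a : a != 0 -> transvection i j a <> 1%g.
Proof.
move=> aN0 /(congr1 val) /= /eqP; rewrite -subr_eq0 addrAC subrr add0r.
move=> /eqP/matrixP/(_ i j)/eqP; rewrite !mxE !eqxx mulr1 intr_eq0.
by rewrite mulf_eq0 (negPf aN0).
Qed.

(** The Steinberg relation; the parameter is [2 * a * b] because the matrix
    entries are twice the parameters. *)
Lemma commg_transvection i j l a b : i != j -> i != l ->
  [~ transvection i j a, transvection j l b]%g = transvection i l (2 * a * b).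
Proof.
move=> ij il; set x := transvection i j a; set y := transvection j l b.
(* Cancelling [y * x] avoids computing inverses. *)
apply: (mulgI (y * x)%g); rewrite -commgC; apply: val_inj.
pose E p q := delta_mx p q : 'M[rat]_3.
pose u := (2 * a)%:~R : rat; pose v := (2 * b)%:~R : rat.
have uv : (2 * (2 * a * b))%:~R = u * v.
  by rewrite /u /v -intrM; congr _%:~R; rewrite mulrACA !mulrA.
change ((1 + u *: E i j) * (1 + v *: E j l) =
  (1 + v *: E j l) * (1 + u *: E i j) *
    (1 + (2 * (2 * a * b))%:~R *: E i l)).
have EE p q r s : E p q * E r s = E p s *+ (q == r).
  exact: mul_delta_mx_cond.
rewrite {}uv !(mulrDl, mulrDr, mul1r, mulr1) -!(scalerAl, scalerAr) !EE.
rewrite eqxx [j == i]eq_sym [l == i]eq_sym (negPf ij) (negPf il) !mulr0n.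
rewrite mul0r !(scaler0, addr0) scalerA !addrA; congr (_ + _).
exact: addrAC.
Qed.

Lemma third_index (i l : 'I_3) : exists j, (i != j) && (j != l).
Proof.
have /subsetPn[j _] : ~~ ([set: 'I_3] \subset [set i; l]).
  apply/negP => /subset_leq_card; rewrite cardsT card_ord cards2.
  by case: (i == l).
by rewrite !inE negb_or eq_sym => ijl; exists j.
Qed.

(** The parameter [a] is the same for all positions [i, j], so that the
    hypothesis for [n] applies at both [(i, j)] and [(j, l)]; it goes from [a]
    to [2 a ^ 2], which never vanishes because the integers have no zero
    divisors. *)
Lemma derived_series_transvection n : exists2 a : int, a != 0 &
  forall i j, i != j ->
    derived_series n (transvection i j a).
Proof.
elim: n => [|n [a aN0 IHn]]; first by exists 1.
exists (2 * a * a); first by rewrite !mulf_neq0.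
move=> i l il; have [j /andP[ij jl]] := third_index i l.
apply: gen_incl; exists (transvection i j a), (transvection j l a).
by split; [exact: IHn | exact: IHn | rewrite commg_transvection //].
Qed.

Theorem mainTheorem4 :
  exists A : skewBraceType,
    solvable_group (additive_group A) /\
    ~ solvable_group (multiplicative_group A).
Proof.
exists (congruence_group : skewBraceType); split.
  exact/commutative_solvable/cong_addC.
move=> [n solv]; have [a aN0 da] := derived_series_transvection n.
apply: (@transvection_neq1 0 1 a aN0).
exact/solv/da.
Qed.
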